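(* Let $X$ be a real topological-linear space, $(Y,\|\cdot\|)$ a real normed space with dimension two or higher, $\Omega\subseteq X$ nonempty, $f:X\to Y$, and $\mathbb A:\Omega\to2^Y$ a cone-valued map. Assume that $K\subseteq Y$ is a nontrivial, closed, convex cone with $0\notin\operatorname{cl}S_{-K}(\|\cdot\|)$, $\bar x\in\mathrm{PEff}_{\mathbb A}(\Omega\mid f,K)$, and $A:=\mathbb A(\bar x)$ is a cone in $Y$ with $\{0\}\ne f[\Omega]-f(\bar x)\subseteq A$. Moreover, assume that one of the following statements is valid: (a) $B_A(\|\cdot\|)$ and $\operatorname{cl}S_{-K}(\|\cdot\|)$ are compact. (b) $A$ is weakly closed, and either $Y$ is reflexive, or $\operatorname{cl}S_{-K}(\|\cdot\|)$ and $\operatorname{cl}_wB_A(\|\cdot\|)$ are weakly compact and $0\notin\operatorname{cl}_wB_A(\|\cdot\|)$. Then there is a norm $\|\cdot\|'$ equivalent to $\|\cdot\|$ and a pair $(x^*,\alpha)\in K^{a\#}(\|\cdot\|')\cap(Y^*\times\mathbb P)$ such that, with $C:=C_{\|\cdot\|'}(x^*,\alpha)$, $\bar x\in\mathrm{Eff}(\Omega\mid f,C)$. Moreover, if $C\neq\ell(C)$ and $\varphi:Y\to\mathbb R$ is a sublinear functional with $\varphi(0)=0$ which is $-C$ representing, then: (i) for any $k\in C\setminus\ell(C)$, $\{(x,0)\mid x\in\Omega,\ f(x)=f(\bar x)\}$ is the set of solutions of $(P_\varphi^{a,k})$ for $a=f(\bar x)$; (ii) $\{x\in\Omega\mid f(x)=f(\bar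 x)\}=\operatorname{argmin}_{x\in\Omega}\varphi(f(x)-f(\bar x))$; (iii) if $\mathcal P\subseteq Y$, $\mathcal T\subseteq C\setminus\ell(C)$, $\mathcal R\subseteq\mathbb R$ satisfy $f[\mathrm{Eff}(\Omega\mid f,C)]\subseteq\mathcal P+\mathcal R\cdot\mathcal T$, then there are $a\in\mathcal P$, $k\in\mathcal T$, $s\in\mathcal R$ so that $\{(x,s)\mid x\in\Omega,\ f(x)=f(\bar x)\}$ is the set of solutions of $(P_\varphi^{a,k})$; (iv) if, in addition to the assumption in (iii), $C$ is closed, then there are $a\in\mathcal P$, $k\in\mathcal T$, $s\in\mathcal R$ so that $\varphi^G_{a-C,k}(f(\bar x))=s$ and $\{x\in\Omega\mid f(x)=f(\bar x)\}=\operatorname{argmin}_{x\in\Omega}\varphi^G_{a-C,k}(f(x))$.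
   Context: $Y^*$ is the topological dual of $Y$, $\mathbb R_+=[0,\infty)$, $\mathbb P=(0,\infty)$. A set $K\subseteq Y$ is a cone if $0\in K=\mathbb R_+\cdot K$; it is nontrivial if $\{0\}\ne K\ne Y$; $\ell(K):=K\cap(-K)$. $\operatorname{cl}$ is the norm closure and $\operatorname{cl}_w$ the weak closure. For a cone $M$ and a norm $\psi$: $B_M(\psi):=\{x\in M\mid\psi(x)=1\}$, $S_M(\psi):=\operatorname{conv}(B_M(\psi))$. $K^{a\#}(\psi):=\{(x^*,\alpha)\in Y^*\times\mathbb R_+\mid\forall y\in K\setminus\{0\}:\ x^*(y)-\alpha\psi(y)>0\}$. $C_\psi(x^*,\alpha):=\{y\in Y\mid x^*(y)\ge\alpha\psi(y)\}$. $\varphi$ is $-C$ representing if $-C=\{y\in Y\mid\varphi(y)\le0\}$. $\mathrm{Eff}(\Omega\mid f,C)$ is the set of $\bar x\in\Omega$ for which there is no $x\in\Omega$ with $f(x)\in f(\bar x)-(C\setminus\{0\})$; $\mathrm{PEff}_{\mathbb A}(\Omega\mid f,K)$ is the set of $\bar x\in\mathrm{Eff}(\Omega\mid f,K)$ with $\mathbb A(\bar x)\cap(-K)=\{0\}$. $f[D]$ is the image of $D$. $(P_\varphi^{a,k})$ is the problem: minimize $\lambda$ subject to $\varphi(f(x)-a-\lambda k)\le0$, $(x,\lambda)\in\Omega\times\mathbb R$; a solution is a feasible pair with $\lambda$ minimal among all feasible pairs. $\varphi^G_{a-C,k}(y):=\inf\{t\in\mathbb R\mid y\in tk+(a-C)\}\in\mathbb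 R\cup\{\pm\infty\}$ ($\inf\emptyset=+\infty$). *)

(* Defs.v *)
From HB Require Import structures.
From mathcomp Require Import all_boot all_order all_algebra.
From mathcomp Require Import all_classical all_reals all_analysis.
Import Order.TTheory GRing.Theory Num.Theory.
Import numFieldNormedType.Exports.

Set Implicit Arguments.
Unset Strict Implicit.
Unset Printing Implicit Defensive.

Local Open Scope classical_set_scope.
Local Open Scope ring_scope.

Section dual.
Context {R : realType} (Y : normedModType R).

Definition dual_pred : {pred Y -> R^o} :=
  mem [set f : Y -> R^o | linear f /\ continuous f].

Lemma dual_submod_closed : submod_closed dual_pred.
Proof.
split.
  apply/mem_set; split; last exact: cst_continuous.
  by move=> a x y; rewrite /= scaler0 addr0.
move=> a f g /set_mem[lf cf] /set_mem[lg cg]; apply/mem_set; split.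
  move=> b x y; rewrite !fctE (lf b x y) (lg b x y).
  rewrite !scalerDr !scalerA [in a * b]mulrC -!addrA; congr (_ + _).
  by rewrite addrCA.
by move=> x; apply: cvgD; [apply: cvgZl_tmp; exact: cf|exact: cg].
Qed.

HB.instance Definition _ :=
  GRing.isSubmodClosed.Build _ _ dual_pred dual_submod_closed.

Record dual := Dual { dual_fun :> Y -> R^o ; _ : dual_fun \in dual_pred }.

HB.instance Definition _ := [isSub for dual_fun].
HB.instance Definition _ := [Choice of dual by <:].
HB.instance Definition _ := [SubChoice_isSubLmodule of dual by <:].

Lemma dual_is_linear (x : dual) : linear (x : Y -> R^o).
Proof. by case: x => f /= /set_mem[]. Qed.

HB.instance Definition _ (x : dual) :=
  GRing.isLinear.Build R Y R^o _ (dual_fun x) (dual_is_linear x).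

Lemma dual_continuous (x : dual) : continuous (x : Y -> R^o).
Proof. by case: x => f /= /set_mem[]. Qed.

Definition dual_norm (x : dual) : R :=
  sup [set `|x y| | y in [set y : Y | `|y| <= 1]].

Let unit_values (x : dual) := [set `|x y| | y in [set y : Y | `|y| <= 1]].

Let unit_values_has_sup x : has_sup (unit_values x).
Proof.
split; first by exists `|x 0|, 0 => //=; rewrite normr0.
have /linear_boundedP : bounded_near (x : {linear Y -> R^o}) (nbhs (0 : Y)).
  exact/linear_bounded_continuous/dual_continuous.
move=> /pinfty_ex_gt0[M M0 xM]; exists M => _ [y /= y1 <-].
by rewrite (le_trans (xM y))// ler_piMr// ltW.
Qed.

Let dual_norm_ub (x : dual) (y : Y) : `|y| <= 1 -> `|x y| <= dual_norm x.
Proof. by move=> y1; apply: (sup_upper_bound (unit_values_has_sup x)); exists y. Qed.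

Let dual_norm_le (x : dual) c :
  (forall y : Y, `|y| <= 1 -> `|x y| <= c) -> dual_norm x <= c.
Proof.
move=> xc; apply: ge_sup => [|_ [y /= y1 <-]]; last exact: xc.
by case: (unit_values_has_sup x).
Qed.

Let dual_norm_ge0 x : 0 <= dual_norm x.
Proof. by rewrite (le_trans _ (@dual_norm_ub x 0 _)) ?normr0. Qed.

Let dual_normD x y : dual_norm (x + y) <= dual_norm x + dual_norm y.
Proof.
apply: dual_norm_le => v v1.
by rewrite (le_trans (ler_normD (x v) (y v)))// lerD// dual_norm_ub.
Qed.

Let dual_normZ_le (a : R) (x : dual) : dual_norm (a *: x) <= `|a| * dual_norm x.
Proof.
apply: dual_norm_le => v v1.
by rewrite (_ : (a *: x) v = a * x v)// normrM ler_wpM2l// dual_norm_ub.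
Qed.

Let dual_normZ (a : R) (x : dual) : dual_norm (a *: x) = `|a| * dual_norm x.
Proof.
apply/eqP; rewrite eq_le dual_normZ_le/=.
have [->|a0] := eqVneq a 0; first by rewrite normr0 mul0r.
rewrite -ler_pdivlMl ?normr_gt0// -normfV.
by rewrite (le_trans _ (dual_normZ_le _ _))// scalerA mulVf// scale1r.
Qed.

Let dual_norm_eq0 x : dual_norm x = 0 -> x = 0.
Proof.
move=> x0; apply/val_inj/funext => y /=.
have [->|y0] := eqVneq y 0; first by rewrite linear0.
have : `|x (`|y|^-1 *: y)| <= 0.
  by rewrite -x0 dual_norm_ub// normrZ normfV normr_id mulVf// normr_eq0.
rewrite normr_le0 linearZ /= mulf_eq0 invr_eq0 normr_eq0 (negbTE y0)/=.
by move/eqP.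
Qed.

HB.instance Definition _ :=
  @Lmodule_isNormed.Build R dual dual_norm dual_normD dual_normZ dual_norm_eq0.

End dual.

Definition reflexive_space {R : realType} (Y : normedModType R) :=
  forall F : dual (dual Y), exists y : Y, forall x : dual Y, F x = x y.

Definition weak {R : realType} (Y : normedModType R) : Type :=
  sup_topology (fun x : dual Y =>
    Topological.class (initial_topology (x : Y -> R^o))).

HB.instance Definition _ (R : realType) (Y : normedModType R) :=
  Topological.copy (weak Y) (sup_topology (fun x : dual Y =>
    Topological.class (initial_topology (x : Y -> R^o)))).

Section weak.
Context {R : realType} {Y : normedModType R}.
Implicit Type A : set Y.

Definition weak_closure A : set Y := @closure (weak Y) A.
Definition weakly_closed A := @closed (weak Y) A.
Definition weakly_compact A := @compact (weak Y) A.

End weak.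

Section norms_and_cones.
Context {R : realType} {Y : normedModType R}.
Implicit Types (A C K M : set Y) (psi phi : Y -> R).

Definition dim_ge2 (V : lmodType R) :=
  exists u v : V, forall a b : R, a *: u + b *: v = 0 -> a = 0 /\ b = 0.

Definition is_norm psi :=
  [/\ forall y, psi y = 0 -> y = 0,
      forall (a : R) y, psi (a *: y) = `|a| * psi y
    & forall y z, psi (y + z) <= psi y + psi z].

Definition equivalent_norm psi :=
  exists c d : R, [/\ 0 < c, 0 < d & forall y, c * `|y| <= psi y <= d * `|y|].

Definition oppset A := [set - y | y in A].

Definition is_cone K := K 0 /\ K = [set t *: y | t in `[0, +oo[ & y in K].

Definition nontrivial K := [set 0] <> K /\ K <> setT.

Definition lin K := K `&` oppset K.

Definition conv_hull A : set Y := smallest (@convex_set R Y) A.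

Definition B_ M psi := [set y | M y /\ psi y = 1].

Definition S_ M psi := conv_hull (B_ M psi).

Definition aug_dual_sharp K psi :=
  [set p : dual Y * R | 0 <= p.2 /\ forall y, (K `\ 0) y -> p.1 y - p.2 * psi y > 0].

Definition BP_cone psi (x : dual Y) (alpha : R) : set Y :=
  [set y | x y >= alpha * psi y].

(* Homogeneity is required for positive scalars only; it forces phi 0 = 0. *)
Definition sublinear phi :=
  (forall (t : R) y, 0 < t -> phi (t *: y) = t * phi y) /\
  (forall y z, phi (y + z) <= phi y + phi z).

Definition representing phi A := A = [set y | phi y <= 0].

Definition phiG a C (k y : Y) : \bar R :=
  ereal_inf [set t%:E | t in
    [set t : R | [set t *: k + z | z in [set a - c | c in C]] y]].

End norms_and_cones.

Definition argmin {X : Type} {d} {T : porderType d} (D : set X) (g : X -> T) :=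
  [set x | D x /\ forall z, D z -> (g x <= g z)%O].

Section efficiency.
Context {R : realType} {X : Type} {Y : normedModType R}.
Implicit Types (Omega : set X) (f : X -> Y) (C K : set Y).

Definition Eff Omega f C :=
  [set xbar | Omega xbar /\
    ~ exists2 x, Omega x & [set f xbar - c | c in C `\ 0] (f x)].

Definition PEff (AA : X -> set Y) Omega f K :=
  [set xbar | Eff Omega f K xbar /\ AA xbar `&` oppset K = [set 0]].

Definition feasible (phi : Y -> R) Omega f (a k : Y) : set (X * R) :=
  [set p | Omega p.1 /\ phi (f p.1 - a - p.2 *: k) <= 0].

Definition solutions (phi : Y -> R) Omega f (a k : Y) : set (X * R) :=
  argmin (feasible phi Omega f a k) snd.

Definition level Omega f (y : Y) := [set x | Omega x /\ f x = y].

End efficiency.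

(* Main.v *)
(** Put L = -K. Hahn-Banach gives a continuous functional l of norm at most 1 with
l >= r |.| on L, because the normalized points of L have convex hull away from 0.
Each compactness assumption, together with A meeting L only at 0, forces a uniform
angle |y - z| >= kappa |y| for y in A and z in L: otherwise a weak cluster point of
nearly optimal unit vectors of A would lie in both A and L, yet have l > 0. The
equivalent norm
  psi y = inf_(z, z' in L) (l z + l z' + 2 |y - z + z'|)
equals l on L, whereas l <= beta psi on A for some beta < 1. Hence for alpha strictly
between beta and 1 the cone {l >= alpha psi} contains L \ {0} in {l > alpha psi} and
meets A only at 0; take x* = -l. The statements about scalarizations only use that C
is a convex cone, that xbar is efficient, and that -k is not in C when k is in
C \ lin C. *)

From HB Require Import structures.
Require Import Defs.
From mathcomp Require Import all_boot all_order all_algebra.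
From mathcomp Require Import all_classical all_reals all_analysis.
From mathcomp Require Import lra.
Import Order.TTheory GRing.Theory Num.Theory.
Import numFieldNormedType.Exports.

Set Implicit Arguments.
Unset Strict Implicit.
Unset Printing Implicit Defensive.

Local Open Scope classical_set_scope.
Local Open Scope ring_scope.

(** * Sublinear functionals and Hahn-Banach *)

Section infconv.
Context {R : realType} {Y : normedModType R}.
Implicit Types (g q : Y -> R) (Q : set (Y * R)) (y z u v : Y) (t : R).

(** A pair [(u, m)] in [Q] encodes the constraint [m <= l u] on a linear functional [l] still to be
    found; such constraints may be added and scaled. *)
Definition convex_cone_pairs Q :=
  [/\ Q (0, 0),
      forall u m v n, Q (u, m) -> Q (v, n) -> Q (u + v, m + n)
    & forall t u m, 0 < t -> Q (u, m) -> Q (t *: u, t * m)].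

Lemma sublinear0 {g} : sublinear g -> g 0 = 0.
Proof. by move=> [gZ _]; have := gZ 2 0 (ltr0Sn _ _); rewrite scaler0; lra. Qed.

Lemma sublinear_geN {g} y : sublinear g -> - g (- y) <= g y.
Proof.
move=> sg; have := sg.2 y (- y); rewrite subrr (sublinear0 sg); lra.
Qed.

Lemma sublinear_norm t : 0 <= t -> sublinear (fun y => t * `|y|).
Proof.
move=> t0; split=> [s y s0|y z].
  by rewrite normrZ gtr0_norm// mulrCA.
by rewrite -mulrDr ler_wpM2l// ler_normD.
Qed.

(* Infimal convolution of [g] with the functional whose epigraph is spanned by the
   pairs [(- u, - m)], [(u, m)] in [Q]. *)
Definition infconv g Q y : R := inf [set g (y + p.1) - p.2 | p in Q].

Section theory.
Variables (g : Y -> R) (Q : set (Y * R)).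
Hypotheses (sg : sublinear g) (cQ : convex_cone_pairs Q).
Hypothesis (Qg : forall u m, Q (u, m) -> m <= g u).

Lemma infconv_le y u m : Q (u, m) -> infconv g Q y <= g (y + u) - m.
Proof.
move=> Qum; apply: ge_inf; last by exists (u, m).
(* This lower bound makes the infimum genuine: [n <= g v <= g (y + v) + g (- y)]. *)
exists (- g (- y)) => _ [[v n] /Qg gv <-] /=.
have := sg.2 (y + v) (- y); rewrite addrAC subrr add0r; lra.
Qed.

Lemma le_infconv y c :
  (forall u m, Q (u, m) -> c <= g (y + u) - m) -> c <= infconv g Q y.
Proof.
case: cQ => Q0 _ _ h; apply: lb_le_inf; first by exists (g (y + 0) - 0), (0, 0).
by move=> _ [[u m] Qum <-]; exact: h.
Qed.

Lemma infconv_le_self y : infconv g Q y <= g y.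
Proof.
by case: cQ => Q0 _ _; have := infconv_le y Q0; rewrite addr0 subr0.
Qed.

Lemma sublinear_infconv : sublinear (infconv g Q).
Proof.
have [Q0 QD QZ] := cQ.
(* One inequality is enough: used with [t^-1] at [t *: y], it yields the reverse one. *)
have Zle t y : 0 < t -> t * infconv g Q y <= infconv g Q (t *: y).
  move=> t0; apply: le_infconv => u m Qum.
  rewrite -ler_pdivlMl//; apply: le_trans (infconv_le y (_ : Q (t^-1 *: u, t^-1 * m))) _.
    by apply: QZ => //; rewrite invr_gt0.
  rewrite mulrBr lerB// -(sg.1 t^-1) ?invr_gt0//.
  by rewrite scalerDr scalerA mulVf ?scale1r// gt_eqF.
split=> [t y t0|y z].
  apply/eqP; rewrite eq_le Zle// andbT -ler_pdivrMl//.
  rewrite (le_trans (Zle _ _ _)) ?invr_gt0//.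
  by rewrite scalerA mulVf ?scale1r// gt_eqF.
rewrite -lerBlDr; apply: le_infconv => u m Qum.
rewrite lerBlDr -lerBlDl; apply: le_infconv => v n Qvn.
have := infconv_le (y + z) (QD _ _ _ _ Qum Qvn).
have := sg.2 (y + u) (z + v); rewrite addrACA; lra.
Qed.

End theory.

Lemma superadditive_linear g : sublinear g ->
  (forall y z, g y + g z <= g (y + z)) -> linear (g : Y -> R^o).
Proof.
move=> sg gD.
have D y z : g (y + z) = g y + g z.
  by apply/eqP; rewrite eq_le gD sg.2.
have N y : g (- y) = - g y.
  by have := D y (- y); rewrite subrr (sublinear0 sg); lra.
move=> t y z; rewrite D; congr (_ + _).
have [t0|t0|<-] := ltgtP 0 t; first exact: sg.1.
  rewrite -[t]opprK scaleNr N sg.1 ?oppr_gt0//.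
  by rewrite scaleNr.
by rewrite !scale0r (sublinear0 sg).
Qed.

(** The chain bound for Zorn's lemma, obtained as a pointwise infimum. The majorant [p] bounds all
    values at [y] below by [- p (- y)]; for subadditivity, the smaller of two members serves at both
    points. *)
Lemma chain_inf_sublinear (F : set (Y -> R)) p :
  (exists q, F q) ->
  (forall q, F q -> sublinear q /\ forall y, q y <= p y) ->
  (forall q r, F q -> F r -> (forall y, q y <= r y) \/ (forall y, r y <= q y)) ->
  exists g, sublinear g /\ forall q, F q -> forall y, g y <= q y.
Proof.
move=> [q0 Fq0] Fs Ftot.
pose g y : R := inf [set q y | q in F].
have gle q y : F q -> g y <= q y.
  move=> Fq; apply: ge_inf; last by exists q.
  exists (- p (- y)) => _ [r Fr <-].
  have [sr rp] := Fs _ Fr.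
  by rewrite (le_trans _ (sublinear_geN y sr))// lerN2.
have leg c y : (forall q, F q -> c <= q y) -> c <= g y.
  move=> h; apply: lb_le_inf; first by exists (q0 y), q0.
  by move=> _ [q Fq <-]; exact: h.
exists g; split; last by move=> q Fq y; exact: gle.
have Zle t y : 0 < t -> t * g y <= g (t *: y).
  move=> t0; apply: (leg) => q Fq.
  by rewrite (Fs _ Fq).1.1// ler_pM2l// gle.
split=> [t y t0|y z].
  apply/eqP; rewrite eq_le Zle// andbT -ler_pdivrMl//.
  rewrite (le_trans (Zle _ _ _)) ?invr_gt0//.
  by rewrite scalerA mulVf ?scale1r// gt_eqF.
rewrite -lerBlDr; apply: (leg) => q Fq.
rewrite lerBlDr -lerBlDl; apply: (leg) => r Fr.
rewrite lerBlDr; case: (Ftot _ _ Fq Fr) => qr.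
  have := gle _ (y + z) Fq; have := (Fs _ Fq).1.2 y z; have := qr z; lra.
have := gle _ (y + z) Fr; have := (Fs _ Fr).1.2 y z; have := qr y; lra.
Qed.

(* A sublinear functional that is minimal for the pointwise order is linear: its
   infimal convolution along a ray [t *: v] cannot be smaller. *)
Lemma linear_minorant p : sublinear p ->
  exists g : Y -> R, linear (g : Y -> R^o) /\ forall y, g y <= p y.
Proof.
move=> sp.
pose T := {q : Y -> R | sublinear q /\ forall y, q y <= p y}.
pose pT : T := exist _ p (conj sp (fun=> lexx _)).
(* The order is reversed, so that a maximal element is a pointwise minimal functional. *)
pose Rel (q r : T) := `[< forall y, sval r y <= sval q y >].
have [|||q qmin] := @ZL_preorder T pT Rel.
- by move=> q; apply/asboolP.
- move=> q r s /asboolP rq /asboolP qs; apply/asboolP => y.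
  exact: le_trans (qs y) (rq y).
- move=> F Ftot.
  have [[q0 Fq0]|F0] := pselect (exists w, F w); last first.
    by exists pT => q Fq; case: F0; exists q.
  have [|||g [sg gF]] := @chain_inf_sublinear [set sval w | w in F] p.
  + by exists (sval q0), q0.
  + by move=> _ [q _ <-]; exact: svalP q.
  + move=> _ _ [q Fq <-] [r Fr <-].
    by case: (Ftot _ _ Fq Fr) => /asboolP; [right|left].
  have gp y : g y <= p y.
    by apply: le_trans (gF (sval q0) _ y) _; [exists q0|exact: (svalP q0).2].
  by exists (exist _ g (conj sg gp)) => q Fq; apply/asboolP/gF; exists q.
case: q qmin => q [sq qp] qmin; exists q; split => //.
apply: superadditive_linear => // y v.
pose Q := [set w : Y * R | exists2 t, 0 <= t & w = (t *: v, t * q v)].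
have cQ : convex_cone_pairs Q.
  split; first by exists 0; rewrite // scale0r mul0r.
  - move=> _ _ _ _ [s s0 [-> ->]] [t t0 [-> ->]]; exists (s + t).
      exact: addr_ge0.
    by rewrite scalerDl mulrDl.
  - move=> t _ _ t0 [s s0 [-> ->]]; exists (t * s).
      by rewrite mulr_ge0// ltW.
    by rewrite scalerA mulrA.
have Qq u m : Q (u, m) -> m <= q u.
  move=> [t]; rewrite le_eqVlt => /predU1P[<-|t0] [-> ->].
    by rewrite scale0r mul0r (sublinear0 sq).
  by rewrite sq.1.
have iq := infconv_le_self sq cQ Qq.
have ip z : infconv q Q z <= p z := le_trans (iq z) (qp z).
have := qmin (exist _ _ (conj (sublinear_infconv sq cQ Qq) ip)).
have -> : Rel (exist _ q (conj sq qp))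
    (exist _ _ (conj (sublinear_infconv sq cQ Qq) ip)) by exact/asboolP.
move=> /(_ isT)/asboolP/(_ y)/= qy.
(* Minimality gives [q y <= infconv q Q y], and the pair [(v, q v)] bounds the right side by
   [q (y + v) - q v]. *)
have := @infconv_le q Q sq Qq y v (q v); rewrite -lerBrDr => h.
apply: le_trans qy (h _); exists 1 => //.
by rewrite scale1r mul1r.
Qed.

Lemma dual_of_bounded (g : Y -> R^o) (M : R) : linear g ->
  (forall y, `|g y| <= M * `|y|) -> exists l : dual Y, forall y, l y = g y.
Proof.
move=> lg gM.
pose isl := GRing.isLinear.Build R Y R^o _ g lg.
pose G : {linear Y -> R^o} := HB.pack g isl.
have cg : continuous g.
  apply: (@linear_bounded_continuous _ _ _ G).1.
  apply/linear_boundedP; near=> r => y.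
  by apply: le_trans (gM y) _; apply: ler_wpM2r.
have gd : (g : Y -> R^o) \in @dual_pred R Y by apply/mem_set.
by exists (Dual gd).
Unshelve. all: by end_near. Qed.

(** Take a linear minorant of the infimal convolution of the norm with [Q]. At [- u] the pair
    [(u, m)] bounds it by [- m], which is the constraint; lying below the norm gives continuity. *)
Lemma dual_minorant Q : convex_cone_pairs Q ->
  (forall u m, Q (u, m) -> m <= `|u|) ->
  exists l : dual Y, (forall u m, Q (u, m) -> m <= l u) /\
    forall y, `|l y| <= `|y|.
Proof.
move=> cQ Qn.
have sn : sublinear (fun y : Y => `|y|).
  by have := sublinear_norm ler01; under eq_fun do rewrite mul1r.
have [g [lg gp]] := linear_minorant (sublinear_infconv sn cQ Qn).
have g0 : g 0 = 0 by have := lg (-1) 0 0; rewrite scaler0 addr0 scaleN1r addNr.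
have gN y : g (- y) = - g y.
  by have := lg (-1) y 0; rewrite !addr0 !scaleN1r g0 addr0.
have gn y : g y <= `|y| := le_trans (gp y) (infconv_le_self sn cQ Qn y).
have [|l lE] := @dual_of_bounded g 1 lg.
  move=> y; rewrite mul1r ler_norml gn andbT lerNl -gN.
  by rewrite (le_trans (gn _))// normrN.
exists l; split=> [u m Qum|y]; rewrite lE.
  rewrite -lerN2 -gN; apply: le_trans (gp _) _.
  by have := infconv_le sn Qn (- u) Qum; rewrite addNr normr0 sub0r.
rewrite ler_norml gn andbT lerNl -gN.
by rewrite (le_trans (gn _))// normrN.
Qed.

End infconv.

(** * Separation of convex cones *)

Section cones.
Context {R : realType} {Y : normedModType R}.
Implicit Types (A K L S : set Y) (y z u v : Y) (t : R).

Lemma is_coneZ K t y : is_cone K -> 0 <= t -> K y -> K (t *: y).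
Proof.
by move=> [_ KE] t0 Ky; rewrite KE; exists t; [rewrite /= in_itv/= t0|exists y].
Qed.

Lemma convex_setP A t y z : convex_set A -> 0 <= t <= 1 -> A y -> A z ->
  A (t *: y + (1 - t) *: z).
Proof.
move=> cA /andP[t0 t1] Ay Az.
have t01 : Itv.spec (@Itv.num_sem R) (Itv.Real `[0%Z, 1%Z]) t.
  by apply/and3P; split; rewrite ?num_real// bnd_simp.
pose k : {i01 R} := Itv.mk t01.
have := cA y z k (mem_set Ay) (mem_set Az). by rewrite inE.
Qed.

Lemma convex_set_conv_hull A : convex_set (conv_hull A).
Proof.
move=> y z k /set_mem hy /set_mem hz; apply/mem_set => M [cM AM].
by apply/set_mem/cM; apply/mem_set; [apply: hy|apply: hz].
Qed.

Definition convex_cone L :=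
  [/\ L 0, forall u v, L u -> L v -> L (u + v)
    & forall t u, 0 < t -> L u -> L (t *: u)].

Lemma convex_cone_oppset K : is_cone K -> convex_set K -> convex_cone (oppset K).
Proof.
move=> coneK convK; split; first by exists 0; rewrite ?oppr0//; exact: coneK.1.
- move=> _ _ [u Ku <-] [v Kv <-]; exists (u + v); last by rewrite opprD.
  have -> : u + v = 2 *: (2^-1 *: u + (1 - 2^-1) *: v).
    rewrite scalerDr !scalerA mulrBr mulfV ?pnatr_eq0// mulr1.
    by rewrite (_ : 2 - 1 = 1 :> R) ?scale1r//; lra.
  by apply: is_coneZ => //; apply: (@convex_setP K) => //; lra.
- move=> t _ t0 [u Ku <-]; exists (t *: u); last by rewrite scalerN.
  by apply: is_coneZ => //; exact: ltW.
Qed.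

Lemma closed_oppset K : closed K -> closed (oppset K).
Proof.
move=> cK; have -> : oppset K = -%R @^-1` K.
  apply/seteqP; split=> [_ [y Ky <-]|y Ky] /=; first by rewrite opprK.
  by exists (- y); rewrite ?opprK.
by apply: closed_comp => // y _; exact: oppr_continuous.
Qed.

Lemma notin_closure_norm S v : ~ closure S v ->
  exists2 r, 0 < r & forall s, S s -> r <= `|v - s|.
Proof.
move=> /existsNP[B /not_implyP[/nbhs_normP[r/= r0 rB] SB]].
exists r => // s Ss; rewrite leNgt; apply/negP => sr.
by apply: SB; exists s; split=> //; exact: rB.
Qed.

(** The constraints are [t * r <= l (t *: v - z)], where [r > 0] bounds the distance from [v] to [L]
    from below. Taking [t = 0] gives the sign on [L]; [t = 1] and [z = 0] give [r <= l v]. *)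
Lemma cone_separation L v : convex_cone L -> closed L -> ~ L v ->
  exists l : dual Y, [/\ forall z, L z -> l z <= 0, 0 < l v
    & forall y, `|l y| <= `|y|].
Proof.
move=> [L0 LD LZ] cL Lv.
have [|r r0 rL] := @notin_closure_norm L v.
  by move: Lv; rewrite {1}(closure_id L).1.
pose Q := [set w : Y * R | exists t z,
  [/\ 0 <= t, L z & w = (t *: v - z, t * r)]].
have [||l [lQ ln]] := @dual_minorant R Y Q.
- split; first by exists 0, 0; rewrite scale0r mul0r subr0.
  + move=> _ _ _ _ [t [z [t0 Lz [-> ->]]]] [s [y [s0 Ly [-> ->]]]].
    exists (t + s), (z + y); split; [exact: addr_ge0|exact: LD|].
    by rewrite scalerDl mulrDl opprD addrACA.
  + move=> s _ _ s0 [t [z [t0 Lz [-> ->]]]]; exists (s * t), (s *: z).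
    split; [by rewrite mulr_ge0// ltW|exact: LZ|].
    by rewrite scalerBr scalerA mulrA.
- move=> _ _ [t [z [+ Lz [-> ->]]]]; rewrite le_eqVlt => /predU1P[<-|t0].
    by rewrite mul0r.
  have -> : t *: v - z = t *: (v - t^-1 *: z).
    by rewrite scalerBr scalerA mulfV ?scale1r// gt_eqF.
  rewrite normrZ gtr0_norm// ler_pM2l// rL//.
  by apply: LZ => //; rewrite invr_gt0.
exists l; split => //.
  move=> z Lz; rewrite -oppr_ge0 -raddfN; apply: lQ.
  by exists 0, z; rewrite scale0r mul0r sub0r.
apply: lt_le_trans r0 (lQ v r _).
by exists 1, 0; rewrite scale1r mul1r subr0.
Qed.

(** The constraint [r <= l s] is imposed on the convex hull of the normalized points and extended to
    the cone over it. Convexity makes these pairs additive, with weights [t / (t + t')], and the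
    pair [(0, 0)] is adjoined. *)
Lemma uniformly_positive_functional L :
  (forall t z, 0 < t -> L z -> L (t *: z)) ->
  ~ closure (S_ L Num.norm) 0 ->
  exists (l : dual Y) (r : R), [/\ 0 < r, r <= 1,
    forall y, `|l y| <= `|y| & forall z, L z -> r * `|z| <= l z].
Proof.
move=> LZ /notin_closure_norm[r r0 rS].
pose S := S_ L Num.norm.
pose Q := [set w : Y * R | w = (0, 0) \/ exists t s,
  [/\ 0 < t, S s & w = (t *: s, t * r)]].
have [||l [lQ ln]] := @dual_minorant R Y Q.
- split; first by left.
  + move=> u m v n [[-> ->]|[t [s [t0 Ss [-> ->]]]]]; first by rewrite !add0r.
    move=> [[-> ->]|[t' [s' [t'0 Ss' [-> ->]]]]].
      by rewrite !addr0; right; exists t, s.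
    right; exists (t + t'), (t / (t + t') *: s + (1 - t / (t + t')) *: s').
    have tt' : t + t' != 0 by rewrite gt_eqF// addr_gt0.
    split; first exact: addr_gt0.
      apply: (@convex_setP (S_ L Num.norm)) => //; first exact: convex_set_conv_hull.
      apply/andP; split; first by apply: divr_ge0; apply: ltW; rewrite ?addr_gt0.
      by rewrite ler_pdivrMr ?addr_gt0// mul1r lerDl ltW.
    rewrite mulrDl scalerDr !scalerA mulrBr mulr1 mulrCA mulfV// mulr1.
    by rewrite addrAC subrr add0r.
  + move=> t _ _ t0 [[-> ->]|[s [z [s0 Sz [-> ->]]]]].
      by left; rewrite scaler0 mulr0.
    by right; exists (t * s), z; rewrite mulr_gt0// scalerA mulrA.
- move=> _ _ [[-> ->]|[t [s [t0 Ss [-> ->]]]]]; first by rewrite normr0.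
  rewrite normrZ gtr0_norm// ler_pM2l//.
  by have := rS _ Ss; rewrite sub0r normrN.
(* Capping the constant at 1 prepares the estimates on the gauge. *)
exists l, (Num.min r 1); split => //; first by rewrite lt_min r0 ltr01.
  by rewrite ge_min lexx orbT.
move=> z Lz; apply: (@le_trans _ _ (r * `|z|)).
  by rewrite ler_wpM2r// ge_min lexx.
have [->|z0] := eqVneq z 0; first by rewrite normr0 mulr0 linear0.
have nz : 0 < `|z| by rewrite normr_gt0.
apply: lQ; right; exists `|z|, (`|z|^-1 *: z); split => //.
  apply: sub_gen_smallest; split; first by apply: LZ; rewrite ?invr_gt0.
  by rewrite normrZ normfV normr_id mulVf// gt_eqF.
by rewrite scalerA mulfV ?gt_eqF// scale1r mulrC.
Qed.

End cones.

(** * The equivalent norm *)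

Section gauge.
Context {R : realType} {Y : normedModType R}.
Variables (L : set Y) (l : dual Y) (r : R).
Hypotheses (cL : convex_cone L) (r0 : 0 < r) (r1 : r <= 1).
Hypotheses (l1 : forall y, `|l y| <= `|y|) (lr : forall z, L z -> r * `|z| <= l z).

Definition gauge_pairs : set (Y * R) :=
  [set w | exists z z', [/\ L z, L z' & w = (z' - z, - (l z + l z'))]].

(** The Minkowski functional of the convex hull of the ball of radius 1/2, the part of [L] where [l]
    is at most 1, and the opposite of that part. *)
Definition gauge : Y -> R := infconv (fun y : Y => 2 * `|y|) gauge_pairs.

Let l_ge0 z : L z -> 0 <= l z.
Proof. by move=> Lz; apply: le_trans (lr Lz); rewrite mulr_ge0// ltW. Qed.

Let sublinear_norm2 : sublinear (fun y : Y => 2 * `|y|).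
Proof. exact: sublinear_norm. Qed.

Let cone_gauge_pairs : convex_cone_pairs gauge_pairs.
Proof.
have [L0 LD LZ] := cL; split.
- by exists 0, 0; rewrite subrr linear0 addr0 oppr0.
- move=> _ _ _ _ [z [z' [Lz Lz' [-> ->]]]] [y [y' [Ly Ly' [-> ->]]]].
  exists (z + y), (z' + y'); split; [exact: LD|exact: LD|].
  by rewrite !(linearD l) -opprD [l z + _ + _]addrACA (opprD z y) [z' - z + _]addrACA.
- move=> t _ _ t0 [z [z' [Lz Lz' [-> ->]]]].
  exists (t *: z), (t *: z'); split; [exact: LZ|exact: LZ|].
  by rewrite scalerBr !linearZ/= mulrN mulrDr.
Qed.

Let gauge_pairs_le u m : gauge_pairs (u, m) -> m <= 2 * `|u|.
Proof.
move=> [z [z' [/l_ge0 lz /l_ge0 lz' [-> ->]]]].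
have := normr_ge0 (z' - z); lra.
Qed.

Lemma gauge_le y z z' : L z -> L z' -> gauge y <= 2 * `|y - z + z'| + l z + l z'.
Proof.
move=> Lz Lz'; have Qzz' : gauge_pairs (z' - z, - (l z + l z')) by exists z, z'.
have := infconv_le sublinear_norm2 gauge_pairs_le y Qzz'.
by rewrite /= opprK (addrA y) [y + z' - z]addrAC addrA.
Qed.

Lemma le_gauge y c :
  (forall z z', L z -> L z' -> c <= 2 * `|y - z + z'| + l z + l z') ->
  c <= gauge y.
Proof.
move=> h; apply: (le_infconv cone_gauge_pairs) => _ _ [z [z' [Lz Lz' [-> ->]]]].
by have := h _ _ Lz Lz'; rewrite opprK (addrA y) [y + z' - z]addrAC addrA.
Qed.

Lemma gauge_le_norm y : gauge y <= 2 * `|y|.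
Proof.
have [L0 _ _] := cL.
by have := gauge_le y L0 L0; rewrite (linear0 l) subr0 !addr0.
Qed.

(** Triangle inequality for [y = w + z - z'], where [l] dominates [r] times the norm at [z] and
    [z'], and [r <= 1] handles the residual [w]. *)
Lemma norm_le_gauge y : r * `|y| <= gauge y.
Proof.
apply: le_gauge => z z' Lz Lz'; have := lr Lz; have := lr Lz'.
have : `|y| <= `|y - z + z'| + `|z| + `|z'|.
  have {1}-> : y = (y - z + z') + z - z' by rewrite [_ + z' + z]addrAC subrK addrK.
  by rewrite (le_trans (ler_normB _ _))// lerD2r ler_normD.
move: r0 r1 (normr_ge0 (y - z + z')) (normr_ge0 z) (normr_ge0 z').
nra.
Qed.

Lemma gaugeN y : gauge (- y) = gauge y.
Proof.
(* Negating the argument amounts to exchanging [z] and [z']. *)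
have le x : gauge x <= gauge (- x).
  apply: le_gauge => z z' Lz Lz'; have := gauge_le x Lz' Lz.
  by rewrite -[`|- x - z + z'|]normrN !opprD !opprK addrAC [_ - z' + z]addrAC addrAC; lra.
by apply/eqP; rewrite eq_le le andbT -{2}[y]opprK le.
Qed.

Lemma is_norm_gauge : is_norm gauge.
Proof.
have sg : sublinear gauge := sublinear_infconv sublinear_norm2 cone_gauge_pairs gauge_pairs_le.
split=> [y y0|a y|]; last exact: sg.2.
  have := norm_le_gauge y; rewrite y0 pmulr_rle0// normr_le0.
  by move/eqP.
have [a0|a0|<-] := ltgtP 0 a; first by rewrite gtr0_norm// sg.1.
  by rewrite -gaugeN -scaleNr ltr0_norm// sg.1// oppr_gt0.
by rewrite scale0r normr0 mul0r (sublinear0 sg).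
Qed.

Lemma equivalent_norm_gauge : equivalent_norm gauge.
Proof. by exists r, 2; split=> // y; rewrite norm_le_gauge gauge_le_norm. Qed.

Lemma gauge_le_functional z : L z -> gauge z <= l z.
Proof.
have [L0 _ _] := cL => Lz; have := gauge_le z Lz L0.
by rewrite addr0 subrr normr0 mulr0 linear0 add0r addr0.
Qed.

(* If [y = z - z' + w] is far from [L], then [w] or [z'] has size comparable to [z],
   which costs a fixed proportion of [l z] in the gauge. *)
Lemma functional_le_gauge (kappa : R) (y : Y) :
  0 < kappa -> (forall z, L z -> kappa * `|y| <= `|y - z|) ->
  l y <= (1 - (2 * (1 / (kappa * r) + 2))^-1) * gauge y.
Proof.
(* The term [1 / (kappa * r)] bounds |y| by a multiple of |w| + [l z']; the added 2 leaves room to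
   bound [l z] by [N] times the same quantity and ensures [2 <= N]. *)
move=> k0 yL; set N := 1 / (kappa * r) + 2.
have kr0 : 0 < kappa * r by rewrite mulr_gt0.
have N2 : 2 <= N by rewrite lerDr divr_ge0// ltW.
have N0 : 0 < N by lra.
set b := 1 - _.
have bN : (1 - b) * N = 2^-1 by rewrite /b opprB addrC subrK invfM mulfVK// gt_eqF.
(* At the end the residual term must absorb half of |w| after [l w] is replaced by |w|, which
   requires [2 * b - 1 >= 2^-1]. *)
have b34 : 3 / 4 <= b.
  have : (2 * N)^-1 <= 4^-1 by rewrite lef_pV2 ?posrE; lra.
  rewrite /b; lra.
rewrite -ler_pdivrMl; last by lra.
apply: le_gauge => z z' Lz Lz'; rewrite ler_pdivrMl; last by lra.
set w := y - z + z'.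
have ly : l y = l z - l z' + l w.
  by rewrite /w !(linearD l) (linearN l); lra.
have lw := le_trans (ler_norm _) (l1 w).
have ly1 := le_trans (ler_norm _) (l1 y).
have lwN' : - l w <= `|w|.
  by rewrite -(linearN l) -(normrN w); exact: le_trans (ler_norm _) (l1 _).
have yw : `|y - z| <= `|w| + `|z'|.
  by rewrite -[y - z](addrK z') ler_normB.
have lz'0 := l_ge0 Lz'.
have yN : `|y| <= (N - 2) * (`|w| + l z').
  rewrite /N addrK mulrC mul1r ler_pdivlMr//.
  have := yL _ Lz; have := lr Lz'.
  move: r0 r1 k0 yw (normr_ge0 w) (normr_ge0 z'); nra.
have lzN : l z <= N * (`|w| + l z') by lra.
have b1 : 0 <= 1 - b by rewrite /b opprB addrC subrK invr_ge0 mulr_ge0// ltW.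
have : (1 - b) * l z <= 2^-1 * (`|w| + l z').
  by rewrite -bN -mulrA ler_wpM2l.
move: b34 (normr_ge0 w); rewrite ly; nra.
Qed.

End gauge.

(** * Weak cluster points and the angle between cones *)

Section clusters.
Context {R : realType} {Y : normedModType R}.
Implicit Types (A L S : set Y) (y z p : Y) (F G : set_system Y).

(** Only one functional is tested at a time. This suffices for separation arguments and lets norm
    compactness, weak compactness and reflexivity be treated alike. *)
Definition weak_cluster F p := forall (x : dual Y) (G : set Y) (e : R),
  F G -> 0 < e -> exists2 y, G y & `|x y - x p| < e.

Lemma weak_cluster_norm F p : cluster F p -> weak_cluster F p.
Proof.
move=> Fp x G e FG e0.
have [|y [Gy ye]] := Fp G (x @^-1` ball (x p) e) FG.
  by apply: (@dual_continuous _ _ x p); exact: nbhsx_ballx.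
by exists y => //; rewrite distrC.
Qed.

Lemma dual_continuous_weak (x : dual Y) : continuous (x : weak Y -> R^o).
Proof.
move=> p; have /cvg_sup/(_ x) h : nbhs (p : weak Y) --> (p : weak Y) by apply: cvg_id.
by apply: cvg_trans (@initial_continuous _ _ (x : Y -> R^o) p); exact: cvg_app.
Qed.

Lemma weak_cluster_weak F p : @cluster (weak Y) F p -> weak_cluster F p.
Proof.
move=> Fp x G e FG e0.
have [|y [Gy ye]] := Fp G (x @^-1` ball (x p) e) FG.
  by apply: (@dual_continuous_weak x p); exact: nbhsx_ballx.
by exists y => //; rewrite distrC.
Qed.

Lemma cvg_weak F p : Filter F -> (forall x : dual Y, x @ F --> x p) ->
  F --> (p : weak Y).
Proof.
move=> FF Fx; apply/cvg_sup => x A.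
move=> /= [B [[C oC <-] Cxp] BA].
by apply: filterS BA _; apply: Fx; apply: open_nbhs_nbhs.
Qed.

Lemma dual_le_norm (x : dual Y) y : `|x y| <= `|x| * `|y|.
Proof.
have [->|y0] := eqVneq y 0; first by rewrite linear0 !normr0 mulr0.
have ny : 0 < `|y| by rewrite normr_gt0.
rewrite -ler_pdivrMr// -[`|y|^-1]gtr0_norm ?invr_gt0// mulrC -normrM.
rewrite -[_ * _]/(_ *: (x y : R^o)) -linearZ /=.
apply: (@ub_le_sup _ [set `|x z| | z in [set z : Y | `|z| <= 1]]).
  have /linear_boundedP : bounded_near (x : {linear Y -> R^o}) (nbhs (0 : Y)).
    exact/linear_bounded_continuous/dual_continuous.
  move=> /pinfty_ex_gt0[M M0 xM]; exists M => _ [z /= z1 <-].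
  by rewrite (le_trans (xM z))// ler_piMr// ltW.
exists (`|y|^-1 *: y) => //=.
by rewrite normrZ normfV normr_id mulVf// gt_eqF.
Qed.

(** Along [F] each functional takes values in a segment, hence converges. The limits form a bounded
    linear functional on the dual, which reflexivity represents by a point. *)
Lemma reflexive_ultra_cvg F (M : R) : reflexive_space Y -> UltraFilter F ->
  F [set y | `|y| <= M] -> exists p, forall x : dual Y, x @ F --> x p.
Proof.
move=> refl UF FM.
have PF : ProperFilter F by exact: ultra_proper.
have xF (x : dual Y) : cvg (x @ F).
  set c := `|x| * M.
  have Fc : (x @ F) [set` `[- c, c]].
    apply: (@filterS _ F _ _ (x @^-1` _) _ FM) => y /= yM.
    by rewrite in_itv/= -ler_norml (le_trans (dual_le_norm x y))// ler_wpM2l.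
  have [p [_ xp]] := @segment_compact R (- c) c (x @ F) _ Fc.
  apply/cvg_ex; exists p => B pB.
  (* A cluster point of an ultrafilter is a limit: otherwise the complement of a neighbourhood would
     belong to the filter. *)
  have [//|FB] := in_ultra_setVsetC (x @^-1` B) UF.
  by have [z []] := xp (~` B) B FB pB.
pose lam (x : dual Y) : R^o := lim (x @ F).
have lamP (x : dual Y) : x @ F --> lam x by exact: xF.
have lam_lin : linear lam.
  move=> t x y; apply: cvg_lim => //.
  by apply: cvgD; [apply: cvgZl_tmp|]; exact: lamP.
have lam_le x : `|lam x| <= M * `|x|.
  have h : `|x y : R^o| @[y --> F] --> `|lam x| by exact: cvg_norm (lamP x).
  rewrite -(cvg_lim _ h)//; apply: limr_le; first by apply/cvg_ex; exists `|lam x|.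
  apply: filterS FM => y /= yM.
  by rewrite (le_trans (dual_le_norm x y))// mulrC ler_wpM2r.
have [Lam LamE] := dual_of_bounded lam_lin lam_le.
have [p pE] := refl Lam.
by exists p => x; rewrite -pE LamE; exact: lamP.
Qed.

(** In the weak cases [p] stays in [A] because [A] is weakly closed. Its norm is not controlled,
    since normalization can be lost in a weak limit. *)
Lemma exists_weak_cluster A F : ProperFilter F -> F (B_ A Num.norm) ->
  compact (B_ A Num.norm) \/
  weakly_closed A /\
    (reflexive_space Y \/ weakly_compact (weak_closure (B_ A Num.norm))) ->
  exists2 p, A p & weak_cluster F p.
Proof.
move=> PF FB [cB|[cA [refl|cB]]].
- by have [p [[Ap _] /weak_cluster_norm Fp]] := cB F PF FB; exists p.
- have [G [UG FG]] := ultraFilterLemma PF.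
  have [p Gp] : exists p, forall x : dual Y, x @ G --> x p.
    apply: (@reflexive_ultra_cvg G 1) => //.
    by apply/FG; apply: filterS FB => y [_ y1]; rewrite /= y1.
  exists p.
    have GA : G A by apply/FG; apply: filterS FB => y [].
    by apply: cA => B /(cvg_weak _ Gp) GB; exact: filter_ex (filterI GA GB).
  move=> x H e /FG GH e0.
  have Gb : G (x @^-1` ball (x p) e) by apply: Gp; exact: nbhsx_ballx.
  have [y [ye Hy]] := filter_ex (filterI Gb GH).
  by exists y => //; rewrite distrC.
- have [|p [Bp /weak_cluster_weak Fp]] := cB F PF.
    by apply: filterS FB; exact: (@subset_closure (weak Y)).
  exists p => //; apply: cA; apply: (@closure_subset (weak Y)) Bp.
  by move=> y [].
Qed.

Lemma cone_distance A L (l : dual Y) (r : R) :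
  (forall F, ProperFilter F -> F (B_ A Num.norm) ->
     exists2 p, A p & weak_cluster F p) ->
  (forall t y, 0 < t -> A y -> A (t *: y)) ->
  convex_cone L -> closed L -> A `&` L `<=` [set 0] ->
  0 < r -> (forall z, L z -> r * `|z| <= l z) -> (forall y, `|l y| <= `|y|) ->
  exists2 kappa : R, 0 < kappa &
    forall y z, A y -> L z -> kappa * `|y| <= `|y - z|.
Proof.
move=> wcA AZ cL; have [_ _ LZ] := cL => clL AL r0 lr l1; apply: contrapT => nk.
(* Without a uniform angle, [A] has unit vectors arbitrarily close to [L]; these sets generate a
   proper filter. *)
pose E e := [set y | B_ A Num.norm y /\ exists2 z, L z & `|y - z| < e].
have E0 e : 0 < e -> E e !=set0.
  move=> e0; apply: contrapT => nE; apply: nk; exists e => // y z Ay Lz.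
  rewrite leNgt; apply/negP => yz; apply: nE.
  have y0 : 0 < `|y|.
    by rewrite -(pmulr_rgt0 _ e0); apply: le_lt_trans yz.
  exists (`|y|^-1 *: y); split.
    split; first by apply: AZ => //; rewrite invr_gt0.
    by rewrite normrZ normfV normr_id mulVf// gt_eqF.
  exists (`|y|^-1 *: z); first by apply: LZ => //; rewrite invr_gt0.
  by rewrite -scalerBr normrZ normfV normr_id mulrC ltr_pdivrMr.
pose F := filter_from [set e : R | 0 < e] E.
have PF : ProperFilter F.
  apply: filter_from_proper => [|e]; last exact: E0.
  apply: filter_from_filter; first by exists 1 => /=.
  move=> d e /= d0 e0; exists (Num.min d e); first by rewrite /= lt_min d0.
  by move=> y [By [z Lz]]; rewrite lt_min => /andP[yd ye]; split; split=> //; exists z.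
have FE e : 0 < e -> F (E e) by exists e.
have [|p Ap Fp] := wcA F PF; first by apply: filterS (FE 1 ltr01) => y [].
(* A functional [g] separating [p] from [L] would exceed [g p / 2] at some [y] closer than [g p / 2]
   to [L], although [g] is nonpositive on [L] and of norm at most 1. *)
have Lp : L p.
  apply: contrapT => nLp; have [g [gL gp g1]] := cone_separation cL clL nLp.
  have e0 : 0 < g p / 2 by rewrite divr_gt0.
  have [y [_ [z /gL gz yz]]] := Fp g _ _ (FE _ e0) e0.
  have := le_trans (ler_norm _) (g1 (y - z)).
  rewrite linearB ltr_norml => h /andP[h1 h2]; move: yz h h1 gz; lra.
have p0 : p = 0 by exact: AL.
(* Since [z] is within 1/4 of a unit vector, [l z > 3 * r / 4]; but [l y] and |y - z| are below
   [r / 4], so [l z < r / 2]. *)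
have e0 : 0 < Num.min (r / 4) 4^-1 by rewrite lt_min divr_gt0//=; lra.
have [y [[_ y1] [z /lr lz]]] := Fp l _ _ (FE _ e0) e0.
rewrite lt_min => /andP[yz1 yz2].
rewrite p0 linear0 subr0 lt_min => /andP[ly _].
have := le_trans (ler_norm _) (l1 (z - y)).
rewrite distrC linearB => h.
have ly' := le_lt_trans (ler_norm _) ly.
have : 1 <= `|z| + `|y - z| by rewrite -y1 -{1}[y](subrK z) addrC ler_normD.
move: yz1 yz2 lz h ly' r0; nra.
Qed.

End clusters.

(** * Scalarization *)

Section scalarization.
Context {R : realType} {X : Type} {Y : normedModType R}.
Variables (Omega : set X) (f : X -> Y) (C : set Y) (xbar : X).
Hypotheses (cC : convex_cone C) (xbar_Eff : Eff Omega f C xbar).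

Lemma Eff_eq x : Omega x -> C (f xbar - f x) -> f x = f xbar.
Proof.
move=> Ox Cx; apply: contrapT => fx; apply: xbar_Eff.2; exists x => //.
exists (f xbar - f x); last by rewrite opprB addrC subrK.
by split => // /subr0_eq /esym.
Qed.

Lemma notin_cone_neg k t : (C `\` lin C) k -> t < 0 -> ~ C (t *: k).
Proof.
have [_ _ CZ] := cC; move=> [Ck nk] t0 Ct; apply: nk; split => //.
exists (- k); last by rewrite opprK.
have := CZ (- t)^-1 _ _ Ct; rewrite scalerA invrN mulNr mulVf ?lt_eqF// scaleN1r.
by apply; rewrite oppr_gt0 invr_lt0.
Qed.

(** If [t < 0], adding [- t *: k] puts [f xbar - f x] in [C], so efficiency forces equality; then
    [t *: k] lies in [C], which [k] outside [lin C] excludes. *)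
Lemma Eff_ray_min k x t : (C `\` lin C) k -> Omega x ->
  C (f xbar - f x + t *: k) -> t <= 0 -> f x = f xbar /\ t = 0.
Proof.
have [_ CD CZ] := cC; move=> kC Ox Ct; rewrite le_eqVlt => /predU1P[t0|t0].
  by split=> //; apply: Eff_eq => //; move: Ct; rewrite t0 scale0r addr0.
have fx : f x = f xbar.
  apply: Eff_eq => //; rewrite -[_ - _]addr0 -(subrr (t *: k)) addrA -scaleNr.
  by apply: CD => //; apply: CZ; [rewrite oppr_gt0|exact: kC.1].
by case: (notin_cone_neg kC t0); move: Ct; rewrite fx subrr add0r.
Qed.

Section representing_functional.
Variables (phi : Y -> R).
Hypotheses (phiC : representing phi (oppset C)).

Lemma representing_le0 y : phi y <= 0 <-> C (- y).
Proof.
have -> : (phi y <= 0) = oppset C y :> Prop by rewrite phiC.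
split=> [[c Cc <-]|Cy]; first by rewrite opprK.
by exists (- y); rewrite ?opprK.
Qed.

(** Writing [a] as [f xbar - s *: k] turns feasibility of [(x, t)] into the condition of
    [Eff_ray_min] with parameter [t - s]. Claim (i) is the case [s = 0], and (iii) the general
    one. *)
Lemma solutions_level a k s : (C `\` lin C) k -> f xbar = a + s *: k ->
  [set (x, s) | x in level Omega f (f xbar)] = solutions phi Omega f a k.
Proof.
have [C0 _ _] := cC; move=> kC fa.
have feasE x t : feasible phi Omega f a k (x, t) <->
    Omega x /\ C (f xbar - f x + (t - s) *: k).
  rewrite /feasible /= representing_le0 fa scalerBl.
  suff -> : - (f x - a - t *: k) = a + s *: k - f x + (t *: k - s *: k) by [].
  rewrite !opprB addrC (addrAC a (s *: k)) -(addrA (a - f x) (s *: k)).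
  by rewrite (addrC (s *: k)) subrK.
have feas_le x t : feasible phi Omega f a k (x, t) -> t <= s ->
    f x = f xbar /\ t = s.
  move=> /feasE[Ox Cx] ts; have [|-> /subr0_eq] := Eff_ray_min kC Ox Cx => //.
  by rewrite subr_le0.
have feasL x : level Omega f (f xbar) x -> feasible phi Omega f a k (x, s).
  by move=> [Ox fx]; apply/feasE; rewrite fx !subrr scale0r add0r.
apply/seteqP; split=> [_ [x Lx <-]|[x t] [fxt min]] /=.
  split=> [|[z t] fz] /=; first exact: feasL.
  rewrite leNgt; apply/negP => ts; have [_ tE] := feas_le _ _ fz (ltW ts).
  by move: ts; rewrite tE ltxx.
have [fx tE] : f x = f xbar /\ t = s.
  by apply: feas_le => //; apply: (min (xbar, s)); apply: feasL; split=> //; exact: xbar_Eff.1.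
by exists x; [split=> //; exact: fxt.1|rewrite tE].
Qed.

Lemma argmin_level : phi 0 = 0 ->
  level Omega f (f xbar) = argmin Omega (fun x => phi (f x - f xbar)).
Proof.
move=> phi0.
have le0 x : Omega x -> phi (f x - f xbar) <= 0 -> f x = f xbar.
  by move=> Ox /representing_le0; rewrite opprB; exact: Eff_eq.
apply/seteqP; split=> [x [Ox fx]|x [Ox min]]; split=> //.
  move=> z Oz; rewrite fx subrr phi0 leNgt; apply/negP => pz.
  by move: (pz); rewrite le0 ?subrr ?phi0 ?ltxx// ltW.
by apply: le0 => //; have := min _ xbar_Eff.1; rewrite subrr phi0.
Qed.

End representing_functional.

Lemma phiG_mem a k y t :
  [set t *: k + z | z in [set a - c | c in C]] y <-> C (a - y + t *: k).
Proof.
split=> [[_ [c Cc <-] <-]|Cy].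
  by rewrite opprD addrA addrAC subrK opprB addrC subrK.
exists (a - (a - y + t *: k)); first by exists (a - y + t *: k).
by rewrite opprD (addrA a) opprB (addrC a) subrK (addrC (t *: k)) subrK.
Qed.

Lemma phiG_Eff a k s : (C `\` lin C) k -> f xbar = a + s *: k ->
  phiG a C k (f xbar) = s%:E.
Proof.
have [C0 _ _] := cC; move=> kC fa.
have memE t : C (a - f xbar + t *: k) <-> C ((t - s) *: k).
  by rewrite fa opprD addrA subrr sub0r scalerBl addrC.
apply/eqP; rewrite eq_le; apply/andP; split.
  apply: ereal_inf_lbound; exists s => //.
  by apply/phiG_mem/memE; rewrite subrr scale0r.
apply: le_ereal_inf_tmp => _ [t /phiG_mem/memE Ct <-].
by rewrite lee_fin -subr_ge0 leNgt; apply/negP => /(notin_cone_neg kC).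
Qed.

(** Attainment of the infimum is not presupposed: one gets [f xbar - f x + e *: k] in [C] for every
    [e > 0], and closedness allows [e] to tend to 0. *)
Lemma phiG_le_eq a k s x : closed C -> (C `\` lin C) k -> f xbar = a + s *: k ->
  Omega x -> (phiG a C k (f x) <= s%:E)%E -> f x = f xbar.
Proof.
have [_ CD CZ] := cC; move=> clC kC fa Ox le_s.
have Ce e : 0 < e -> C (f xbar - f x + e *: k).
  move=> e0; have : (phiG a C k (f x) < (s + e)%:E)%E.
    by apply: le_lt_trans le_s _; rewrite lte_fin ltrDl.
  move=> /ereal_inf_lt[_ [t /phiG_mem Ct <-]]; rewrite lte_fin => tse.
  have -> : f xbar - f x + e *: k = a - f x + t *: k + (s + e - t) *: k.
    rewrite -(addrA (a - f x)) -scalerDl (addrC t) subrK fa (addrAC a).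
    by rewrite -(addrA (a - f x)) -scalerDl.
  by apply: CD => //; apply: CZ; [rewrite subr_gt0|exact: kC.1].
apply: Eff_eq => //; apply: clC => B /nbhs_normP[r /= r0 rB].
have k1 : 0 < `|k| + 1 by rewrite ltr_wpDl.
have e0 : 0 < r / (`|k| + 1) by rewrite divr_gt0.
exists (f xbar - f x + (r / (`|k| + 1)) *: k); split; first exact: Ce.
apply: rB => /=; rewrite opprD addrA subrr sub0r normrN normrZ gtr0_norm//.
by rewrite mulrAC ltr_pdivrMr// ltr_pM2l// ltrDl.
Qed.

Lemma argmin_phiG_level a k s : closed C -> (C `\` lin C) k ->
  f xbar = a + s *: k ->
  level Omega f (f xbar) = argmin Omega (fun x => phiG a C k (f x)).
Proof.
move=> clC kC fa; have fG := phiG_Eff kC fa.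
apply/seteqP; split=> [x [Ox fx]|x [Ox min]]; split=> //.
  move=> z Oz; rewrite fx fG leNgt; apply/negP => pz.
  by move: (pz); rewrite (phiG_le_eq clC kC fa Oz (ltW pz)) fG ltxx.
by apply: (phiG_le_eq clC kC fa Ox); rewrite -fG; exact: min xbar_Eff.1.
Qed.

End scalarization.

(** * Bishop-Phelps cones and assembly of the theorem *)

Lemma convex_cone_BP_cone (R : realType) (Y : normedModType R) (psi : Y -> R)
    (x : dual Y) (alpha : R) :
  is_norm psi -> 0 <= alpha -> convex_cone (BP_cone psi x alpha).
Proof.
move=> [_ psiZ psiD] a0; split.
- by rewrite /BP_cone /= linear0 -(scale0r 0) psiZ normr0 mul0r mulr0.
- move=> u v; rewrite /BP_cone /= linearD => xu xv.
  by apply: le_trans (lerD xu xv); rewrite -mulrDr ler_wpM2l.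
- move=> t u t0; rewrite /BP_cone /= linearZ psiZ gtr0_norm// mulrCA => xu.
  by rewrite ler_pM2l.
Qed.

(** If [f z = f xbar - c], then [- c] lies in [A], and the strict inequality there excludes a
    nonzero [c] from the cone. *)
Lemma Eff_BP_cone (R : realType) (X : Type) (Y : normedModType R)
    (Omega : set X) (f : X -> Y) (A : set Y) (xbar : X)
    (psi : Y -> R) (x : dual Y) (alpha : R) :
  Omega xbar -> [set f x - f xbar | x in Omega] `<=` A ->
  (forall y, A (- y) -> y <> 0 -> x y < alpha * psi y) ->
  Eff Omega f (BP_cone psi x alpha) xbar.
Proof.
move=> Oxbar fA xA; split=> // -[z Oz [c [Cc c0] fz]].
have := xA c; rewrite ltNge Cc => /(_ _ c0)/negP; apply => //.
by apply: fA; exists z => //; rewrite -fz addrC addrA addNr add0r.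
Qed.

Lemma exists_separating_BP_cone (R : realType) (Y : normedModType R) (A K : set Y) :
  closed K -> convex_set K -> is_cone K -> ~ closure (S_ (oppset K) Num.norm) 0 ->
  is_cone A -> A `&` oppset K `<=` [set 0] ->
  compact (B_ A Num.norm) \/
    weakly_closed A /\
      (reflexive_space Y \/ weakly_compact (weak_closure (B_ A Num.norm))) ->
  exists (psi : Y -> R) (x : dual Y) (alpha : R),
    [/\ is_norm psi, equivalent_norm psi, aug_dual_sharp K psi (x, alpha), 0 < alpha
      & forall y, A (- y) -> y <> 0 -> x y < alpha * psi y].
Proof.
move=> clK convK coneK S0 coneA AK cA.
have cL := convex_cone_oppset coneK convK.
have clL := closed_oppset clK.
have [_ _ LZ] := cL.
have [l [r [r0 r1 l1 lr]]] := uniformly_positive_functional LZ S0.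
have [kappa k0 Ak] : exists2 kappa : R, 0 < kappa &
    forall y z, A y -> oppset K z -> kappa * `|y| <= `|y - z|.
  apply: (@cone_distance _ _ _ _ l r) => //.
    by move=> F PF FB; exact: exists_weak_cluster.
  by move=> t y t0; apply: is_coneZ => //; exact: ltW.
pose psi := gauge (oppset K) l.
have npsi : is_norm psi := is_norm_gauge cL r0 r1 lr.
have epsi : equivalent_norm psi := equivalent_norm_gauge cL r0 r1 lr.
have psi_gt0 y : y <> 0 -> 0 < psi y.
  move=> /eqP y0; apply: lt_le_trans (norm_le_gauge cL r0 r1 lr y).
  by rewrite mulr_gt0// normr_gt0.
have psiN y : psi (- y) = psi y := gaugeN cL r0 lr y.
set d := (2 * (1 / (kappa * r) + 2))^-1.
have d0 : 0 < d.
  by rewrite invr_gt0 mulr_gt0// addr_gt0// divr_gt0// mulr_gt0.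
have d1 : d <= 4^-1.
  rewrite lef_pV2 ?posrE//; last by rewrite -invr_gt0.
  have : 0 <= 1 / (kappa * r) by rewrite divr_ge0// mulr_ge0// ltW.
  lra.
(* The midpoint of [1 - d], the ratio available on [A], and 1, the ratio on [oppset K]; [d <= 4^-1]
   keeps it positive. The sign passes from [oppset K] to [K]. *)
exists psi, (- l), (1 - d / 2); split => //.
- split=> [/=|y [Ky y0]]; first lra.
  have Ly : oppset K (- y) by exists y.
  have := gauge_le_functional cL r0 lr Ly.
  rewrite -/psi psiN linearN => ly.
  have -> : (- l) y = - l y by [].
  have := psi_gt0 _ y0; rewrite /=; nra.
- lra.
- move=> y Ay y0; have -> : (- l) y = l (- y) by rewrite linearN.
  have := functional_le_gauge cL r0 r1 l1 lr k0 (fun z Lz => Ak _ _ Ay Lz).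
  rewrite -/psi psiN -/d; have := psi_gt0 _ y0; nra.
Qed.

Theorem corollary34 (R : realType) (X : topologicalLmodType R)
    (Y : normedModType R) (dimY : dim_ge2 Y)
    (Omega : set X) (Omega0 : Omega !=set0) (f : X -> Y)
    (AA : X -> set Y) (coneAA : forall x, Omega x -> is_cone (AA x))
    (K : set Y) (K_nontrivial : nontrivial K) (K_closed : closed K)
    (K_convex : convex_set K) (K_cone : is_cone K)
    (S_0 : ~ closure (S_ (oppset K) Num.norm) 0)
    (xbar : X) (xbar_PEff : PEff AA Omega f K xbar)
    (A : set Y) (defA : A = AA xbar) (A_cone : is_cone A)
    (fOmega_neq0 : [set 0] <> [set f x - f xbar | x in Omega])
    (fOmega_sub : [set f x - f xbar | x in Omega] `<=` A)
    (compactness :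
      (compact (B_ A Num.norm) /\
       compact (closure (S_ (oppset K) Num.norm))) \/
      (weakly_closed A /\
       (reflexive_space Y \/
        [/\ weakly_compact (closure (S_ (oppset K) Num.norm)),
            weakly_compact (weak_closure (B_ A Num.norm))
          & ~ weak_closure (B_ A Num.norm) 0]))) :
  exists (norm' : Y -> R) (xstar : dual Y) (alpha : R),
    [/\ is_norm norm', equivalent_norm norm',
        aug_dual_sharp K norm' (xstar, alpha), 0 < alpha &
      let C := BP_cone norm' xstar alpha in
      Eff Omega f C xbar /\
      (C <> lin C ->
       forall phi : Y -> R,
         sublinear phi -> phi 0 = 0 -> representing phi (oppset C) ->
         [/\
          (* (i) *)
          forall k, (C `\` lin C) k ->
            [set (x, 0 : R) | x in level Omega f (f xbar)] =
            solutions phi Omega f (f xbar) k,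
          (* (ii) *)
          level Omega f (f xbar) =
            argmin Omega (fun x => phi (f x - f xbar)),
          (* (iii) *)
          forall (P T : set Y) (S : set R), T `<=` C `\` lin C ->
            f @` Eff Omega f C `<=`
              [set p + r | p in P & r in [set s *: t | s in S & t in T]] ->
            exists a k s, [/\ P a, T k, S s &
              [set (x, s) | x in level Omega f (f xbar)] =
              solutions phi Omega f a k]
          (* (iv) *)
        & forall (P T : set Y) (S : set R), T `<=` C `\` lin C ->
            f @` Eff Omega f C `<=`
              [set p + r | p in P & r in [set s *: t | s in S & t in T]] ->
            closed C ->
            exists a k s, [/\ P a, T k, S s,
              phiG a C k (f xbar) = s%:E &
              level Omega f (f xbar) =
              argmin Omega (fun x => phiG a C k (f x))]])].
Proof.
have cpt : compact (B_ A Num.norm) \/ weakly_closed A /\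
    (reflexive_space Y \/ weakly_compact (weak_closure (B_ A Num.norm))).
  by case: compactness => [[cB _]|[wA [refl|[_ cB _]]]]; [left|right; split; auto..].
have [[Oxbar _] AK] := xbar_PEff.
have AK0 : A `&` oppset K `<=` [set 0] by rewrite defA AK.
have [psi [xstar [alpha [npsi epsi sharp alpha0 xA]]]] :=
  exists_separating_BP_cone K_closed K_convex K_cone S_0 A_cone AK0 cpt.
exists psi, xstar, alpha; split => // C.
have cC : convex_cone C by apply: convex_cone_BP_cone => //; exact: ltW.
have effC : Eff Omega f C xbar by exact: Eff_BP_cone Oxbar fOmega_sub xA.
split=> // _ phi _ phi0 phiC.
(* Shared by (iii) and (iv): as [xbar] is efficient for [C], the covering applies to [f xbar] itself
   and supplies the triple. *)
have decomp (P T : set Y) (S : set R) : T `<=` C `\` lin C ->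
    f @` Eff Omega f C `<=`
      [set p + r | p in P & r in [set s *: t | s in S & t in T]] ->
    exists a k s, [/\ P a, T k, S s, (C `\` lin C) k & f xbar = a + s *: k].
  move=> TC /(_ (f xbar)) [|a Pa [_ [s Ss [k Tk <-]] fa]]; first by exists xbar.
  by exists a, k, s; split=> //; exact: TC.
split.
- move=> k kC; apply: (solutions_level cC effC phiC kC).
  by rewrite scale0r addr0.
- exact: (argmin_level effC phiC phi0).
- move=> P T S TC /(decomp _ _ _ TC)[a [k [s [Pa Tk Ss kC fa]]]].
  by exists a, k, s; split=> //; exact: (solutions_level cC effC phiC kC).
- move=> P T S TC /(decomp _ _ _ TC)[a [k [s [Pa Tk Ss kC fa]]]] clC.
  exists a, k, s; split=> //; first exact: phiG_Eff.
  exact: (argmin_phiG_level cC effC clC kC fa).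
Qed.
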